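(* Assume $p\in(1,\infty)$ and $c=0$. Let $g:X\to(0,\infty)$ and let $\rho$ be a pseudo-metric on $X$ which is $p$-intrinsic for $b$ over $(X,|g|m)$. Then $$\frac{1}{h(b,m|g|)}\le\|g\|_{\mathcal H}\le\frac{2^{1-p}p^p}{h(b\rho,m|g|)^p},$$ where the quotients are infinite if the denominator is zero.
   Context: Setting: $X$ is an infinite countable set, $m:X\to(0,\infty)$ is a measure of full support, extended to subsets by $m(A)=\sum_{x\in A}m(x)$ (likewise for $m|g|$). $C_c(X)$ is the set of finitely supported real functions on $X$, and $W\Subset X$ means $W$ is a finite subset of $X$. $b:X\times X\to[0,\infty)$ is a connected graph over $(X,m)$: symmetric, zero diagonal, $\sum_{y}b(x,y)<\infty$ for all $x$, and any two vertices are joined by a finite path along which $b>0$. With $c=0$ the energy functional is $Q(\varphi)=\frac12\sum_{x,y\in X}b(x,y)|\varphi(x)-\varphi(y)|^p$, $\varphi\in C_c(X)$, and $$\|g\|_{\mathcal H}=\sup_{\varphi\in C_c(X),\,Q(\varphi)\ne0}\frac{\sum_X m|g||\varphi|^p}{Q(\varphi)}\in[0,\infty].$$ Cheeger constant: for a symmetric weight $a:X\times X\to[0,\infty)$ and a measure $\mu:X\to(0,\infty)$, $h(a,\mu)=\inf_{\emptyset\ne W\Subset X}\frac{a(\partial W)}{\mu(W)}$, where $\partial W=W\times(X\setminus W)$ and $a(\partial W)=\sum_{(x,y)\in\partial W}a(x,y)$. Here $b\rho$ is the weight $(x,y)\mapsto b(x,y)\rho(x,y)$. With $1/p+1/q=1$,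 a pseudo-metric $\rho$ on $X$ is called $p$-intrinsic for $b$ over $(X,\mu)$ if $\frac1{\mu(x)}\sum_{y\in X}b(x,y)\rho(x,y)^q\le1$ for all $x\in X$. *)

(* Defs.v *)
From HB Require Import structures.
From mathcomp Require Import all_boot all_order all_algebra.
From mathcomp Require Import all_classical all_reals all_analysis.
Set Implicit Arguments.
Unset Strict Implicit.
Unset Printing Implicit Defensive.
Import Order.TTheory GRing.Theory Num.Theory.
Import numFieldNormedType.Exports.
Local Open Scope classical_set_scope.
Local Open Scope ring_scope.

Section Defs.
Variables (R : realType) (X : choiceType).
Implicit Types (b a rho : X -> X -> R) (m mu g phi : X -> R) (p : R).

Record connected_graph b : Prop := ConnectedGraph {
  graph_ge0 : forall x y, 0 <= b x y;
  graph_sym : forall x y, b x y = b y x;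
  graph_diag : forall x, b x x = 0;
  graph_summable : forall x, (\esum_(y in [set: X]) (b x y)%:E < +oo)%E;
  graph_connected : forall x y,
    exists s : seq X, path (fun u v => 0 < b u v) x s /\ last x s = y
}.

Definition Cc : set (X -> R) := [set phi | finite_set [set x | phi x != 0]].

(* Sums of nonnegative terms are taken in [0, +oo], unconditionally. *)
Definition energy b p phi : \bar R :=
  ((2^-1)%:E * \esum_(z in [set: X * X])
     (b z.1 z.2 * `|phi z.1 - phi z.2| `^ p)%:E)%E.

Definition density m g : X -> R := fun x => m x * `|g x|.

Definition hardy_norm b m p g : \bar R :=
  ereal_sup [set ((\esum_(x in [set: X]) (density m g x * `|phi x| `^ p)%:E)
                    / energy b p phi)%E
            | phi in [set phi | Cc phi /\ energy b p phi <> 0%E]].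

Definition measure_of mu (A : set X) : \bar R := \esum_(x in A) (mu x)%:E.

Definition edge_boundary (W : set X) : set (X * X) := W `*` ~` W.

Definition weight_of a (E : set (X * X)) : \bar R :=
  \esum_(z in E) (a z.1 z.2)%:E.

Definition cheeger a mu : \bar R :=
  ereal_inf [set (weight_of a (edge_boundary W) / measure_of mu W)%E
            | W in [set W | finite_set W /\ W !=set0]].

Record pseudo_metric rho : Prop := PseudoMetric {
  pseudo_metric_ge0 : forall x y, 0 <= rho x y;
  pseudo_metric_refl : forall x, rho x x = 0;
  pseudo_metric_sym : forall x y, rho x y = rho y x;
  pseudo_metric_triangle : forall x y z, rho x z <= rho x y + rho y z
}.

Definition intrinsic p b mu rho : Prop :=
  pseudo_metric rho /\
  forall q, p^-1 + q^-1 = 1 -> forall x,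
    (((mu x)^-1)%:E *
      (\esum_(y in [set: X]) (b x y * rho x y `^ q)%:E) <= 1)%E.

End Defs.

(* Main.v *)
(* Testing the Hardy inequality on the indicator of a finite set [W] gives the
   ratio [mu(W) / b(dW)], hence the lower bound.

   For the upper bound, let [h] be the Cheeger constant of [b rho] and
   [f = |phi|^p].  The co-area inequality gives
   [h * mu(f) <= 1/2 * sum b rho |f x - f y|].  Instead of Hoelder's inequality,
   the right-hand side is bounded termwise by
   [rho |s^p - t^p| <= k^(p-1) |s - t|^p + (p-1)/(2k) rho^q (s^p + t^p)], which
   sums to [k^(p-1) Q(phi) + (p-1)/(2k) mu(f)] because [rho] is intrinsic.  With
   [k = p / (2h)] the last term is [(1 - 1/p) h mu(f)] and is absorbed on the
   left, leaving [h^p mu(f) <= 2^(1-p) p^p Q(phi)]. *)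
Require Import Defs.
From HB Require Import structures.
From mathcomp Require Import all_boot all_order all_algebra.
From mathcomp Require Import all_classical all_reals all_analysis.
From mathcomp Require Import ring lra.
Import Order.TTheory GRing.Theory Num.Theory.
Import numFieldNormedType.Exports.
Local Open Scope classical_set_scope.
Local Open Scope ring_scope.

(** * Scalar inequalities for real powers *)

Lemma conjugate_exponent (R : realType) (p : R) : 1 < p ->
  p^-1 + (p / (p - 1))^-1 = 1.
Proof. by move=> p1; field; apply/andP; split; lra. Qed.

Lemma conjugate_exponent_ge1 (R : realType) (p : R) : 1 < p -> 1 <= p / (p - 1).
Proof. by move=> p1; rewrite ler_pdivlMr; lra. Qed.

(** Young's inequality for [x] and [t ^ (p - 1)] with exponents [p] and [p / (p - 1)], multiplied by
    [p]. This gives convexity with the endpoints [x = 0] and [t = 0] included. *)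
Lemma powR_tangent_le (R : realType) (p x t : R) : 1 < p -> 0 <= x -> 0 <= t ->
  t `^ p + p * t `^ (p - 1) * (x - t) <= x `^ p.
Proof.
move=> p1 x0 t0; have p0 : 0 < p by lra.
have pB1 : 0 < p - 1 by lra.
have := conjugate_powR x0 (powR_ge0 t (p - 1)) p0
  (divr_gt0 p0 pB1) (conjugate_exponent _ _ p1).
rewrite -powRrM mulrCA divff ?gt_eqF// mulr1 invf_div.
rewrite -(ler_pM2l p0) mulrDr (mulrCA p (x `^ p)) divff ?gt_eqF// mulr1.
have := mulr_powRB1 t0 p0; set u := t `^ (p - 1) => <- H.
have E : p * (t * u * ((p - 1) / p)) = t * u * (p - 1) by field; lra.
rewrite E in H; nra.
Qed.

(* After subtracting the right-hand side, the derivative in [t] is bounded below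
   by two tangent-line inequalities for [s |-> s ^ p] at [t]. *)
Lemma powR_sub_le_pos (R : realType) (p tau s t : R) :
  1 < p -> 0 < tau -> 0 < s -> s < t ->
  t `^ p - s `^ p <=
    (t - s) * (tau `^ (p - 1) + (p - 1) / (2 * tau) * (t `^ p + s `^ p)).
Proof.
move=> p1 tau0 s0 st; have p0 : 0 < p by lra.
pose c := (p - 1) / (2 * tau).
pose F := fun z : R => (z - s) * (tau `^ (p - 1) + c * (z `^ p + s `^ p)) - z `^ p.
pose dF := fun z : R => (tau `^ (p - 1) + c * (z `^ p + s `^ p))
   + (z - s) * (c * (p * z `^ (p - 1))) - p * z `^ (p - 1).
have FdF (z : R) : 0 < z -> is_derive z 1 F (dF z).
  move=> z0; have := is_derive1_powR p z0 => D.
  rewrite /F; apply: is_derive_eq.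
  rewrite /GRing.scale/= /dF; ring.
have [] := @MVT _ F dF s t st.
- by move=> z; rewrite in_itv/= => /andP[sz _]; apply: FdF; lra.
- apply: derivable_within_continuous => z; rewrite in_itv/= => /andP[sz _].
  by have [] : is_derive z 1 F (dF z) by apply: FdF; lra.
move=> z; rewrite in_itv/= => /andP[sz zt] FE.
suff dF0 : 0 <= dF z.
  have : 0 <= F t - F s by rewrite FE mulr_ge0//; lra.
  rewrite /F -/c; lra.
have z0 : 0 < z by lra.
(* The tangent at [z] is evaluated at [s] and at [tau]. In [tau * dF z] the first contributes at
   least [(p - 1) z^p] and the second at least [-(p - 1) z^p]. This exact cancellation dictates the
   coefficient [(p - 1) / (2 tau)]. *)
have T1 := powR_tangent_le _ _ _ _ p1 (ltW s0) (ltW z0).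
have T2 := powR_tangent_le _ _ _ _ p1 (ltW tau0) (ltW z0).
have c0 : 0 <= c by rewrite divr_ge0//; lra.
rewrite -(pmulr_lge0 _ tau0) /dF.
have := mulr_powRB1 (ltW tau0) p0.
have ctau : c * tau = (p - 1) / 2 by rewrite /c; field; lra.
have zz := mulr_powRB1 (ltW z0) p0.
move: T1 T2 zz; set u := z `^ (p - 1); set v := tau `^ (p - 1) => T1 T2 zz tt.
rewrite -zz -tt in T1 T2 *.
have -> : (v + c * (z * u + s `^ p) + (z - s) * (c * (p * u)) - p * u) * tau =
  tau * v + (c * tau) * (z * u + s `^ p + (z - s) * (p * u)) - p * u * tau by ring.
rewrite ctau; nra.
Qed.

(** The mean value argument differentiates powers at positive points only. The case [s = 0] is its
    limit along small positive [e], carried out by contradiction. *)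
Lemma powR_sub_le (R : realType) (p tau s t : R) :
  1 < p -> 0 < tau -> 0 <= s -> s <= t ->
  t `^ p - s `^ p <=
    (t - s) * (tau `^ (p - 1) + (p - 1) / (2 * tau) * (t `^ p + s `^ p)).
Proof.
move=> p1 tau0; rewrite le_eqVlt => /predU1P[<-|s0]; last first.
  rewrite le_eqVlt => /predU1P[<-|]; first by rewrite !subrr mul0r.
  exact: powR_sub_le_pos.
have p0 : 0 < p by lra.
rewrite le_eqVlt => /predU1P[<-|t0]; first by rewrite !subrr mul0r.
rewrite powR0 ?gt_eqF// subr0 addr0 subr0.
set c := (p - 1) / (2 * tau); have c0 : 0 <= c by rewrite divr_ge0//; lra.
rewrite leNgt; apply/negP; rewrite -subr_gt0; set D := _ - _ => D0.
pose C := 1 + c * t; have C0 : 0 < C by rewrite /C; have := mulr_ge0 c0 (ltW t0); lra.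
(* With [D] the assumed violation at [s = 0], the inequality at [s = e] would force [D <= C * e^p].
   This [e] lies below [t] and makes [C * e^p <= D / 2]. *)
pose e := Num.min (t / 2) ((D / (2 * C)) `^ (p^-1)).
have DC0 : 0 < D / (2 * C) by rewrite divr_gt0//; lra.
have e0 : 0 < e by rewrite lt_min powR_gt0// andbT; lra.
have et : e < t by rewrite gt_min; apply/orP; left; lra.
have sp : e `^ p <= D / (2 * C).
  have -> : D / (2 * C) = ((D / (2 * C)) `^ (p^-1)) `^ p.
    by rewrite -powRrM mulVf ?gt_eqF// powRr1// ltW.
  apply: ge0_ler_powR; rewrite ?nnegrE ?powR_ge0 ?(ltW e0) ?(ltW p0)//.
  by rewrite ge_min lexx orbT.
have := powR_sub_le_pos _ _ _ _ _ p1 tau0 e0 et; rewrite -/c.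
have : C * e `^ p <= D / 2.
  rewrite (le_trans (ler_wpM2l (ltW C0) sp))// le_eqVlt; apply/orP; left.
  by apply/eqP; field; lra.
have sp0 := powR_ge0 e p; have tp0 := powR_ge0 t p.
have := powR_ge0 tau (p - 1); move: D0; rewrite /D /C.
move: (t `^ p) (e `^ p) (tau `^ (p - 1)) sp0 tp0 => T S V S0 T0 D0 V0.
have H1 : e * (V + c * (T + S)) >= 0.
  by rewrite mulr_ge0 ?(ltW e0)// addr_ge0// mulr_ge0// addr_ge0.
lra.
Qed.

(** This takes the place of Hoelder's inequality: [r] ends up only in the second term, with the
    conjugate exponent that the intrinsic condition controls, and [k] stays free for
    optimisation. *)
Lemma weighted_powR_sub_le (R : realType) (p k r s t : R) :
  1 < p -> 0 < k -> 0 <= r -> 0 <= s -> 0 <= t ->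
  r * `|t `^ p - s `^ p| <= k `^ (p - 1) * `|t - s| `^ p +
    (p - 1) / (2 * k) * (r `^ (p / (p - 1)) * (t `^ p + s `^ p)).
Proof.
move=> p1 k0 r0; have p0 : 0 < p by lra.
wlog st : s t / s <= t.
  move=> wl s0 t0; have [|/ltW] := leP s t; first by move/wl; exact.
  by move/wl => /(_ t0 s0); rewrite (distrC (s `^ p)) (distrC s) (addrC (s `^ p)).
move=> s0 t0.
have P1 : 0 <= t `^ p - s `^ p.
  by rewrite subr_ge0 ge0_ler_powR// ?nnegrE// ltW.
rewrite ger0_norm// (ger0_norm (_ : 0 <= t - s)) ?subr_ge0//.
have RHS : 0 <= k `^ (p - 1) * (t - s) `^ p +
    (p - 1) / (2 * k) * (r `^ (p / (p - 1)) * (t `^ p + s `^ p)).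
  have c0 : 0 <= (p - 1) / (2 * k) by rewrite divr_ge0//; lra.
  apply: addr_ge0; first by rewrite mulr_ge0 ?powR_ge0.
  by rewrite mulr_ge0// mulr_ge0 ?powR_ge0// addr_ge0 ?powR_ge0.
(* If [s = t] or [r = 0] the left-hand side vanishes. These cases go first because the [tau] chosen
   below must be positive. *)
move: st; rewrite le_eqVlt => /predU1P[E|st]; first by rewrite {1}E subrr mulr0.
move: r0; rewrite le_eqVlt => /predU1P[E|r0]; first by rewrite -{1}E mul0r.
set q := p / (p - 1) in RHS *.
have d0 : 0 < t - s by lra.
(* This choice of [tau] makes both terms of [powR_sub_le] match. *)
pose tau := (t - s) * k * r `^ (1 - q).
have rq : 0 < r `^ (1 - q) by exact: powR_gt0.
have tau0 : 0 < tau by rewrite !mulr_gt0.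
have := powR_sub_le _ _ _ _ _ p1 tau0 s0 (ltW st).
rewrite -(ler_pM2l r0) => /le_trans; apply.
rewrite le_eqVlt; apply/orP; left; apply/eqP.
rewrite [in LHS]mulrA [in LHS]mulrDr; congr (_ + _).
  rewrite /tau !powRM ?mulr_ge0 ?ltW//.
  rewrite -powRrM (_ : (1 - q) * (p - 1) = -1); last by rewrite /q; field; lra.
  rewrite powR_inv1 ?ltW// -(mulr_powRB1 (ltW d0) p0).
  by field; lra.
have -> : r `^ q = r / r `^ (1 - q).
  rewrite powRB ?powRr1 ?(ltW r0) ?(gt_eqF r0) ?implybT//.
  by have := powR_gt0 q r0 => ?; field; apply/andP; split; lra.
rewrite /tau; field.
by do ?[apply/andP; split]; lra.
Qed.

(** * Unconditional sums in [[0, +oo]] *)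

Lemma le_esumZl (R : realType) (T : choiceType) (A : set T) (r : R)
    (F : T -> \bar R) : (forall x, (0 <= F x)%E) -> 0 < r ->
  (\esum_(x in A) (r%:E * F x) <= r%:E * \esum_(x in A) F x)%E.
Proof.
move=> F0 r0; apply: ge_ereal_sup => _ /= [B [finB BA] <-].
rewrite -ge0_mule_fsumr// lee_pmul2l ?lte_fin//.
by apply: ereal_sup_ubound; exists B.
Qed.

Lemma esumZl (R : realType) (T : choiceType) (A : set T) (r : R)
    (F : T -> \bar R) : (forall x, (0 <= F x)%E) -> 0 <= r ->
  (\esum_(x in A) (r%:E * F x) = r%:E * \esum_(x in A) F x)%E.
Proof.
move=> F0; rewrite le_eqVlt => /predU1P[<-|r0].
  by rewrite mul0e esum1// => x _; rewrite mul0e.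
apply/eqP; rewrite eq_le le_esumZl//=.
(* The converse is the same inequality for the factor [r^-1] and the family [r * F]. *)
rewrite -lee_pdivlMl//.
have rF0 x : (0 <= r%:E * F x)%E by rewrite mule_ge0// lee_fin ltW.
have ri : 0 < r^-1 by rewrite invr_gt0.
apply: le_trans (le_esumZl _ _ A _ _ rF0 ri).
by apply: le_esum => x _; rewrite muleA -EFinM mulVf ?gt_eqF// mul1e.
Qed.

Lemma esumZl_fin (R : realType) (T : choiceType) (A : set T) (r : R)
    (F : T -> R) : (forall x, 0 <= F x) -> 0 <= r ->
  (\esum_(x in A) (r * F x)%:E = r%:E * \esum_(x in A) (F x)%:E)%E.
Proof. by move=> F0 r0; rewrite -esumZl// => x; rewrite lee_fin. Qed.

Lemma esumD_fin (R : realType) (T : choiceType) (A : set T) (F G : T -> R) :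
  (forall x, 0 <= F x) -> (forall x, 0 <= G x) ->
  (\esum_(x in A) (F x + G x)%:E =
   \esum_(x in A) (F x)%:E + \esum_(x in A) (G x)%:E)%E.
Proof. by move=> F0 G0; rewrite -esumD// => x _; rewrite lee_fin. Qed.

Lemma esum_swap (R : realType) (T : choiceType) (F : T * T -> \bar R) :
  (\esum_(z in [set: T * T]) F z = \esum_(z in [set: T * T]) F (z.2, z.1))%E.
Proof.
apply: reindex_esum; split=> //= [[x y] [x' y'] _ _ [-> ->]//|[x y] _].
by exists (y, x).
Qed.

Lemma esum_pair (R : realType) (T1 T2 : choiceType) (F : T1 * T2 -> \bar R) :
  (forall z, 0 <= F z)%E ->
  (\esum_(z in [set: T1 * T2]) F z =
   \esum_(x in [set: T1]) \esum_(y in [set: T2]) F (x, y))%E.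
Proof.
move=> F0; rewrite esum_esum//.
rewrite (_ : [set: T1] `*`` _ = setT); last by apply/seteqP; split.
by apply: eq_esum => -[].
Qed.

Lemma esum_term_le (R : realType) (T : choiceType) (A : set T)
    (F : T -> \bar R) x : A x -> (F x <= \esum_(y in A) F y)%E.
Proof.
move=> Ax; apply: esum_ge; exists [set x]; last by rewrite fsbig_set1.
by split=> // y ->.
Qed.

(** Applied to [mu * |phi|^p], this gives the finiteness that allows this mass to be subtracted from
    both sides when it is absorbed. *)
Lemma esum_finite_supp (R : realType) (T : choiceType) (A : set T) (F : T -> R) :
  (forall x, 0 <= F x) -> finite_set [set x | F x != 0] ->
  (\esum_(x in A) (F x)%:E < +oo)%E.
Proof.
move=> F0 finF; have finAF : finite_set (A `&` [set x | F x != 0]).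
  exact: finite_setIr.
rewrite (esumID [set x | F x != 0]); last by move=> x _; rewrite lee_fin.
rewrite [X in (_ + X)%E]esum1 ?adde0; last first.
  by move=> x [_ /= /negP]; rewrite negbK => /eqP ->.
rewrite esum_fset//; last by move=> x _; rewrite lee_fin.
by rewrite fsumEFin// ltry.
Qed.

(** * Edge boundaries and the co-area inequality *)

Lemma esum_boundary (R : realType) (X : choiceType) (a : X -> X -> R)
    (W : set X) : (forall x y, 0 <= a x y) -> (forall x y, a x y = a y x) ->
  (\esum_(z in [set: X * X])
     (a z.1 z.2 * ((z.1 \in W) != (z.2 \in W))%:R)%:E =
   2%:E * weight_of a (edge_boundary W))%E.
Proof.
move=> a0 asym.
pose F (z : X * X) := a z.1 z.2 * ((z.1 \in W) && (z.2 \notin W))%:R.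
have F0 z : 0 <= F z by rewrite mulr_ge0.
have FE : weight_of a (edge_boundary W) = (\esum_(z in [set: X * X]) (F z)%:E)%E.
  rewrite /weight_of esum_mkcond; apply: eq_esum => -[x y] _.
  rewrite /edge_boundary in_setX/= in_setC /F/=.
  by case: ifP => _; rewrite ?mulr1 ?mulr0.
(* A pair separated by [W] either leaves [W] or enters it. The entering pairs are the swapped
   leaving ones and, by symmetry of [a], have the same total weight. *)
transitivity (\esum_(z in [set: X * X]) (F z + F (z.2, z.1))%:E)%E.
  apply: eq_esum => -[x y] _; congr EFin; rewrite /F/= (asym y x).
  by case: (x \in W); case: (y \in W); rewrite /= ?mulr0 ?mulr1 ?addr0 ?add0r.
rewrite esumD_fin// -(esum_swap _ _ (fun z => (F z)%:E)) -FE.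
by rewrite (_ : 2%:E = 1%:E + 1%:E)%E// ge0_muleDl ?lee_fin// mul1e.
Qed.

Lemma seq_argmin (R : realType) (T : eqType) (f : T -> R) (s : seq T) :
  s != [::] -> exists2 x, x \in s & forall y, y \in s -> f x <= f y.
Proof.
elim: s => // x s IH _; have [->|/IH[z zs zmin]] := eqVneq s [::].
  by exists x; rewrite ?mem_head// => y; rewrite inE => /eqP ->.
have [xz|/ltW zx] := leP (f x) (f z).
  exists x; rewrite ?mem_head// => y; rewrite inE => /predU1P[->//|/zmin].
  exact: le_trans.
exists z; first by rewrite inE zs orbT.
by move=> y; rewrite inE => /predU1P[->//|/zmin].
Qed.

(* Induction on the support: the smallest positive value [t] of [f] is peeled
   off as [t] times the indicator of the support, and both sides are additive
   along this decomposition. *)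
Lemma cheeger_coarea (R : realType) (X : choiceType) (a : X -> X -> R)
    (mu : X -> R) (h : R) :
  (forall x y, 0 <= a x y) -> (forall x y, a x y = a y x) ->
  (forall x, 0 <= mu x) -> 0 <= h ->
  (forall W, finite_set W -> W !=set0 ->
     (h%:E * measure_of mu W <= weight_of a (edge_boundary W))%E) ->
  forall f : X -> R, (forall x, 0 <= f x) -> finite_set [set x | f x != 0] ->
  (h%:E * (\esum_(x in [set: X]) (mu x * f x)%:E) <=
   (2^-1)%:E *
     \esum_(z in [set: X * X]) (a z.1 z.2 * `|f z.1 - f z.2|)%:E)%E.
Proof.
move=> a0 asym mu0 h0 hW f f0 /finite_seqP[s fs].
have {}fs x : f x != 0 -> x \in s.
  by move=> fx; have : [set` s] x by rewrite -fs.
have [n] := ubnP (size s); elim: n f f0 s fs => // n IH f f0 s fs sn.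
pose s1 := [seq x <- s | f x != 0].
have s1P x : (x \in s1) = (f x != 0).
  by rewrite mem_filter; apply/andb_idr => /fs.
have [s10|] := eqVneq s1 [::].
  rewrite [X in (h%:E * X)%E]esum1 ?mule0; last first.
    by move=> x _; have := s1P x; rewrite s10 => /esym/eqP ->; rewrite mulr0.
  by rewrite mule_ge0// esum_ge0// => z _; rewrite lee_fin mulr_ge0.
move/(@seq_argmin _ _ f) => [x0]; rewrite s1P => fx0 x0min.
set t := f x0 in x0min.
have t0 : 0 < t by rewrite lt_def fx0 f0.
pose W := [set x | f x != 0].
have WE x : (x \in W) = (f x != 0) by apply/idP/idP => [/set_mem|/mem_set].
pose f' x := if f x != 0 then f x - t else 0.
have f'0 x : 0 <= f' x.
  by rewrite /f'; case: ifPn => // fx; rewrite subr_ge0 x0min ?s1P.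
pose s2 := [seq y <- s1 | f' y != 0].
have f's x : f' x != 0 -> x \in s2.
  move=> f'x; rewrite mem_filter f'x s1P; apply: contraNN f'x.
  by rewrite /f' => ->.
(* The minimiser [x0] lies in the support of [f] but not in that of [f'], so the list strictly
   shrinks. *)
have sz : (size s2 < n)%N.
  apply: leq_trans (_ : size s <= n)%N => //.
  apply: leq_trans (_ : size s1 <= _)%N; last by rewrite size_filter count_size.
  rewrite size_filter ltn_neqAle count_size andbT -all_count.
  by apply/allPn; exists x0; rewrite ?s1P// /f' fx0 subrr eqxx.
have {}IH := IH f' f'0 _ f's sz.
have fE x : mu x * f x = mu x * f' x + t * (mu x * (x \in W)%:R).
  by rewrite WE /f'; have [->|_] := eqVneq (f x) 0; rewrite /= ?mulr0 ?addr0//; ring.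
(* Subtracting [t] on [W] cancels when both points are in [W]. When exactly one is, the difference
   drops by exactly [t], since [f'] stays nonnegative by minimality of [t]. *)
have dE x y : a x y * `|f x - f y| = a x y * `|f' x - f' y| +
    t * (a x y * ((x \in W) != (y \in W))%:R).
  rewrite mulrCA -mulrDr; congr (_ * _); rewrite !WE.
  have := f'0 x; have := f'0 y; rewrite /f'.
  have [->|fx] := eqVneq (f x) 0; have [->|fy] := eqVneq (f y) 0 => /= y0 x0'.
  - by rewrite subrr mulr0 addr0.
  - by rewrite !sub0r !normrN !ger0_norm//; lra.
  - by rewrite !subr0 !ger0_norm//; lra.
  - by rewrite mulr0 addr0; congr `|_|; ring.
under eq_esum do rewrite fE.
under [X in (_ <= _ * X)%E]eq_esum do rewrite dE.
have ind0 x : 0 <= mu x * (x \in W)%:R by rewrite mulr_ge0.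
have inda0 (z : X * X) : 0 <= a z.1 z.2 * ((z.1 \in W) != (z.2 \in W))%:R.
  by rewrite mulr_ge0.
rewrite !esumD_fin; last first.
- by move=> x; rewrite mulr_ge0// ltW.
- by move=> x; rewrite mulr_ge0.
- by move=> x; rewrite mulr_ge0// ltW.
- by move=> x; rewrite mulr_ge0.
rewrite !esumZl_fin ?(ltW t0)// esum_boundary//.
rewrite !ge0_muleDr; try by rewrite ?mule_ge0 ?lee_fin ?(ltW t0)// esum_ge0// => x _; rewrite lee_fin ?mulr_ge0.
apply: leeD => //.
rewrite !(muleCA _ t%:E) lee_pmul2l ?lte_fin//.
(* The [2] from counting each boundary edge in both directions cancels the [1/2], leaving the
   Cheeger inequality for [W]. *)
rewrite muleA -EFinM mulVf// mul1e.
have finW : finite_set W.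
  apply: (@sub_finite_set _ _ [set` s]); last exact: finite_seq.
  by move=> x /fs.
have Wne : W !=set0 by exists x0.
apply: le_trans (hW W finW Wne).
rewrite lee_pmul//; first by apply: esum_ge0 => x _; rewrite lee_fin.
rewrite /measure_of [leRHS]esum_mkcond; apply: le_esum => x _.
by case: ifP => _; rewrite lee_fin ?mulr1 ?mulr0.
Qed.

(** * Cheeger constants and the lower bound *)

Lemma measure_of_fin (R : realType) (X : choiceType) (mu : X -> R) (W : set X) :
  (forall x, 0 < mu x) -> finite_set W -> W !=set0 ->
  exists2 r : R, 0 < r & measure_of mu W = r%:E.
Proof.
move=> mu0 finW [x Wx]; exists (\sum_(y \in W) mu y).
  rewrite -lte_fin -fsumEFin// -esum_fset//; last first.
    by move=> y _; rewrite lee_fin ltW.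
  apply: lt_le_trans (esum_term_le _ _ _ (fun y => (mu y)%:E) _ Wx).
  by rewrite lte_fin.
rewrite /measure_of esum_fset ?fsumEFin//.
by move=> y _; rewrite lee_fin ltW.
Qed.

Lemma cheeger_ge0 (R : realType) (X : choiceType) (a : X -> X -> R)
    (mu : X -> R) : (forall x y, 0 <= a x y) -> (forall x, 0 < mu x) ->
  (0 <= cheeger a mu)%E.
Proof.
move=> a0 mu0; apply: le_ereal_inf_tmp => _ [W _ <-].
rewrite mule_ge0 ?inve_ge0// esum_ge0// => z _; rewrite lee_fin//.
exact: ltW.
Qed.

(** A path from a point of [W] to a point outside, which exists because the vertex set is infinite,
    must cross the boundary along an edge of positive weight. Hence indicators have nonzero energy
    and are admissible test functions. *)
Lemma connected_boundary_gt0 (R : realType) (X : choiceType) (b : X -> X -> R)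
    (W : set X) : infinite_set [set: X] -> connected_graph b ->
  finite_set W -> W !=set0 -> (0 < weight_of b (edge_boundary W))%E.
Proof.
move=> Xinf bG finW [x Wx].
have [y Wy] : exists y, ~ W y.
  by apply/existsNP => WT; apply: Xinf; apply: sub_finite_set finW => z _; exact: WT.
have [s [ps ls]] := graph_connected bG x y.
suff [u [v [Wu Wv buv]]] : exists u v, [/\ W u, ~ W v & 0 < b u v].
  apply: lt_le_trans (esum_term_le _ _ _
    (fun z => (b z.1 z.2)%:E) (u, v) (conj Wu Wv)).
  by rewrite lte_fin.
elim: s x Wx ps ls => [x Wx _ /= xy|z s IH x Wx /= /andP[bxz ps] ls].
  by rewrite xy in Wx.
have [Wz|Wz] := pselect (W z); first exact: (IH z).
by exists x, z.
Qed.

Lemma energy_indicator (R : realType) (X : choiceType) (b : X -> X -> R)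
    (p : R) (W : set X) : connected_graph b -> p != 0 ->
  energy b p (fun x => (x \in W)%:R) = weight_of b (edge_boundary W).
Proof.
move=> bG p0; rewrite /energy.
have -> : (\esum_(z in [set: X * X])
    (b z.1 z.2 * `|(z.1 \in W)%:R - (z.2 \in W)%:R| `^ p)%:E =
    \esum_(z in [set: X * X])
      (b z.1 z.2 * ((z.1 \in W) != (z.2 \in W))%:R)%:E)%E.
  apply: eq_esum => -[x y] _ /=; congr (_ * _)%:E.
  case: (x \in W); case: (y \in W);
    by rewrite /= ?subrr ?sub0r ?subr0 ?normrN ?normr0 ?normr1 ?powR0 ?powR1.
rewrite esum_boundary; [|exact: graph_ge0|exact: graph_sym].
by rewrite muleA -EFinM mulVf// mul1e.
Qed.

Lemma density_gt0 (R : realType) (X : choiceType) (m g : X -> R) :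
  (forall x, 0 < m x) -> (forall x, 0 < g x) -> forall x, 0 < density m g x.
Proof. by move=> m0 g0 x; rewrite mulr_gt0// gtr0_norm. Qed.

Lemma hardy_norm_ge_inv_cheeger (R : realType) (X : choiceType) (b : X -> X -> R)
    (m g : X -> R) (p : R) :
  infinite_set [set: X] -> connected_graph b -> 0 < p ->
  (forall x, 0 < density m g x) ->
  ((cheeger b (density m g))^-1 <= hardy_norm b m p g)%E.
Proof.
move=> Xinf bG p0 mu0.
have ratio_le W : finite_set W -> W !=set0 ->
    (measure_of (density m g) W / weight_of b (edge_boundary W) <=
     hardy_norm b m p g)%E.
  move=> finW Wne; apply: ereal_sup_ubound.
  exists (fun x => (x \in W)%:R).
    split; last first.
      rewrite energy_indicator ?gt_eqF//; apply/eqP; rewrite gt_eqF//.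
      exact: connected_boundary_gt0.
    apply: sub_finite_set finW => x /=.
    by case: (boolP (x \in W)) => [/set_mem//|_]; rewrite /= eqxx.
  rewrite energy_indicator ?gt_eqF//; congr (_ / _)%E.
  rewrite /measure_of [RHS]esum_mkcond; apply: eq_esum => x _.
  by case: ifP => _; rewrite ?normr1 ?normr0 ?powR1 ?mulr1 ?powR0 ?gt_eqF ?mulr0.
have [x0 _] := infinite_setN0 Xinf.
have H0 : (0 <= hardy_norm b m p g)%E.
  apply: le_trans (ratio_le [set x0] (finite_set1 _) _); last by exists x0.
  apply: mule_ge0; last rewrite inve_ge0; apply: esum_ge0 => z _; rewrite lee_fin.
    exact: ltW.
  exact: graph_ge0.
(* Inverting both sides turns the claim into a lower bound on an infimum, to be checked for each [W]
   separately. *)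
rewrite inve_ple ?inE//; last by apply: cheeger_ge0 => //; exact: graph_ge0.
apply: le_ereal_inf_tmp => _ [W [finW Wne] <-].
have := ratio_le W finW Wne.
have := connected_boundary_gt0 _ _ _ _ Xinf bG finW Wne.
have [r r0 ->] := measure_of_fin _ _ _ _ mu0 finW Wne.
case: (weight_of _ _) => [w||]//; last by rewrite inver gt_eqF// gt0_mulye ?leey// lte_fin invr_gt0.
rewrite lte_fin => w0; rewrite !inver !gt_eqF// -!EFinM => rw.
have -> : (w / r)%:E = ((r / w)%:E)^-1%E.
  by rewrite inver gt_eqF ?divr_gt0// invf_div.
by rewrite lee_pV2 ?inE ?lee_fin ?divr_ge0 ?(ltW r0) ?(ltW w0).
Qed.

Lemma cheeger_mul_le (R : realType) (X : choiceType) (a : X -> X -> R)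
    (mu : X -> R) (h : R) (W : set X) :
  (forall x, 0 < mu x) -> cheeger a mu = h%:E -> finite_set W -> W !=set0 ->
  (h%:E * measure_of mu W <= weight_of a (edge_boundary W))%E.
Proof.
move=> mu0 hE finW Wne.
have : (cheeger a mu <= weight_of a (edge_boundary W) / measure_of mu W)%E.
  by apply: ereal_inf_lbound; exists W.
have [r r0 ->] := measure_of_fin _ _ _ _ mu0 finW Wne.
by rewrite hE inver gt_eqF// lee_pdivlMr.
Qed.

(** * The upper bound from an intrinsic pseudo-metric *)

Section Intrinsic.
Variables (R : realType) (X : choiceType) (b rho : X -> X -> R) (p : R).
Variable mu : X -> R.
Hypotheses (bG : connected_graph b) (p_gt1 : 1 < p).
Hypotheses (mu_gt0 : forall x, 0 < mu x) (rhoI : intrinsic p b mu rho).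
Let q := p / (p - 1).

Lemma brho_ge0 x y : 0 <= b x y * rho x y.
Proof.
by rewrite mulr_ge0//; [exact: graph_ge0|exact: (pseudo_metric_ge0 rhoI.1)].
Qed.

Lemma intrinsic_sum_le x :
  (\esum_(y in [set: X]) (b x y * rho x y `^ q)%:E <= (mu x)%:E)%E.
Proof.
have := rhoI.2 q (conjugate_exponent _ _ p_gt1) x.
by rewrite lee_pdivrMl// mule1.
Qed.

(** Tested on one point [x]: since [rho <= 1 + rho^q], the boundary weight is at most the sum of
    [b x y] plus that of [b x y * rho x y ^ q], and both are finite. *)
Lemma intrinsic_cheeger_lty : [set: X] !=set0 ->
  (cheeger (fun x y => (b x y * rho x y)%R) mu < +oo)%E.
Proof.
move=> [x _]; set W := [set x].
have finW : finite_set W by exact: finite_set1.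
have Wne : W !=set0 by exists x.
apply: (@le_lt_trans _ _ (weight_of (fun x y => (b x y * rho x y)%R)
  (edge_boundary W) / measure_of mu W)%E).
  by apply: ereal_inf_lbound; exists W.
have [r r0 ->] := measure_of_fin _ _ _ _ mu_gt0 finW Wne.
rewrite inver gt_eqF// muleC lte_mul_pinfty ?lee_fin ?invr_ge0 ?(ltW r0)//.
have b0 u v : 0 <= b u v by exact: graph_ge0.
pose F y := b x y + b x y * rho x y `^ q.
have F0 y : 0 <= F y by rewrite addr_ge0// mulr_ge0// powR_ge0.
apply: (@le_lt_trans _ _ (\esum_(y in [set: X]) (F y)%:E)%E); last first.
  rewrite esumD_fin//; last by move=> y; rewrite mulr_ge0// powR_ge0.
  apply: lte_add_pinfty; first exact: graph_summable.
  exact: le_lt_trans (intrinsic_sum_le x) (ltry _).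
have -> : edge_boundary W = [set (x, y) | y in ~` W].
  apply/seteqP; split=> [[u v] [/= -> Wv]|_ [y Wy <-]]; first by exists v.
  by split.
rewrite /weight_of esum_image; last by move=> u v _ _ [].
rewrite [leLHS]esum_mkcond; apply: le_esum => y _; case: ifP => _; rewrite lee_fin//=.
rewrite /F -{2}(mulr1 (b x y)) -mulrDr ler_wpM2l//.
have rxy : 0 <= rho x y by exact: (pseudo_metric_ge0 rhoI.1).
have q1 := conjugate_exponent_ge1 _ _ p_gt1.
have [r1|/ltW r1] := leP 1 (rho x y); last by rewrite ler_wpDr ?powR_ge0.
by rewrite ler_wpDl// le1r_powR.
Qed.

Lemma hardy_cheeger_bound (h : R) (phi : X -> R) :
  cheeger (fun x y => b x y * rho x y) mu = h%:E -> 0 < h -> Cc phi ->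
  ((h `^ p)%:E * (\esum_(x in [set: X]) (mu x * `|phi x| `^ p)%:E) <=
   (2 `^ (1 - p) * p `^ p)%:E * energy b p phi)%E.
Proof.
move=> hE h0 phic; have p0 := lt_trans ltr01 p_gt1.
have b0 x y : 0 <= b x y by exact: graph_ge0.
have rho0 x y : 0 <= rho x y by exact: (pseudo_metric_ge0 rhoI.1).
have mu0 x : 0 <= mu x by exact: ltW.
pose f x := `|phi x| `^ p.
have f0 x : 0 <= f x by exact: powR_ge0.
have fphi x : (f x != 0) = (phi x != 0).
  by rewrite powR_eq0 normr_eq0 (gt_eqF p0) andbT.
have ffin : finite_set [set x | f x != 0].
  by apply: sub_finite_set phic => x /=; rewrite fphi.
(* Among [k > (p - 1) / (2h)], this value minimises [k^(p-1) / (h - (p-1)/(2k))], the constant left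
   after absorption. *)
pose k := p / (2 * h); have k0 : 0 < k by rewrite divr_gt0// mulr_gt0.
pose c := (p - 1) / (2 * k).
have c0 : 0 <= c.
  by rewrite divr_ge0 ?subr_ge0 ?(ltW p_gt1)// mulr_ge0// ltW.
have cE : c = (1 - p^-1) * h.
  by rewrite /c /k; field; rewrite !gt_eqF.
set M := (\esum_(x in _) _)%E.
have Mfin : (M < +oo)%E.
  apply: (esum_finite_supp _ _ _ (fun x => mu x * f x)) => [x|].
    by rewrite mulr_ge0.
  by apply: sub_finite_set ffin => x /=; rewrite mulf_eq0 negb_or => /andP[].
have M0 : (0 <= M)%E.
  by apply: esum_ge0 => x _; rewrite lee_fin mulr_ge0// powR_ge0.
pose E (z : X * X) := b z.1 z.2 * `|phi z.1 - phi z.2| `^ p.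
pose G (z : X * X) := b z.1 z.2 * rho z.1 z.2 `^ q * f z.1.
have E0 z : 0 <= E z by rewrite mulr_ge0// powR_ge0.
have G0 z : 0 <= G z by rewrite !mulr_ge0// powR_ge0.
(* [G] carries [f] at the first endpoint only, so summing over the second one first meets the
   intrinsic bound at [x]. *)
have GM : (\esum_(z in [set: X * X]) (G z)%:E <= M)%E.
  rewrite esum_pair; last by move=> z; rewrite lee_fin.
  apply: le_esum => x _.
  under eq_esum do rewrite /G/= mulrC.
  rewrite esumZl_fin//; last by move=> y; rewrite mulr_ge0// powR_ge0.
  rewrite mulrC EFinM lee_wpmul2l ?lee_fin//; exact: intrinsic_sum_le.
have key : (h%:E * M <= (k `^ (p - 1))%:E * energy b p phi + c%:E * M)%E.
  apply: le_trans (cheeger_coarea _ _ _ _ _ brho_ge0 _ mu0 (ltW h0) _ f f0 ffin) _.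
  - move=> x y; rewrite (graph_sym bG); congr (_ * _).
    exact: (pseudo_metric_sym rhoI.1).
  - by move=> W; exact: cheeger_mul_le.
  pose B z := k `^ (p - 1) * E z + c * (G z + G (z.2, z.1)).
  apply: (@le_trans _ _ ((2^-1)%:E * \esum_(z in [set: X * X]) (B z)%:E)%E).
    rewrite lee_wpmul2l ?lee_fin ?invr_ge0//.
    apply: le_esum => -[x y] _; rewrite lee_fin /B /E /G/=.
    rewrite (graph_sym bG y x) (pseudo_metric_sym rhoI.1 y x).
    rewrite -mulrA.
    have := weighted_powR_sub_le _ _ _ _ _ _ p_gt1 k0 (rho0 x y)
      (normr_ge0 (phi y)) (normr_ge0 (phi x)).
    rewrite -/c -/q -/(f x) -/(f y).
    (* The scalar inequality concerns [|phi x|] and [|phi y|]; the reverse triangle inequality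
       passes to [phi x - phi y]. *)
    have : `| `|phi x| - `|phi y| | `^ p <= `|phi x - phi y| `^ p.
      by rewrite ge0_ler_powR ?nnegrE ?normr_ge0 ?(ltW p0)// ler_dist_dist.
    move=> /(ler_wpM2l (powR_ge0 k (p - 1))) H1 H2.
    have /(ler_wpM2l (b0 x y)) := le_trans H2 (lerD H1 (lexx _)).
    move=> /le_trans; apply; rewrite le_eqVlt; apply/orP; left; apply/eqP; ring.
  rewrite esumD_fin; last 2 first.
  - by move=> z; rewrite mulr_ge0// powR_ge0.
  - by move=> z; rewrite mulr_ge0// addr_ge0.
  rewrite !esumZl_fin ?powR_ge0//; last by move=> z; rewrite addr_ge0.
  rewrite esumD_fin// -(esum_swap _ _ (fun z => (G z)%:E)).
  rewrite ge0_muleDr; last 2 first.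
  - by rewrite mule_ge0 ?lee_fin ?powR_ge0// esum_ge0// => z _; rewrite lee_fin.
  - by rewrite mule_ge0 ?lee_fin// adde_ge0// esum_ge0// => z _; rewrite lee_fin.
  rewrite !(muleCA (2^-1)%:E); apply: leeD; first by [].
  rewrite lee_wpmul2l ?lee_fin//.
  (* Each endpoint contributes at most [M], and the factor [1/2] compensates for having two. *)
  apply: (@le_trans _ _ ((2^-1)%:E * (M + M))%E).
    by rewrite lee_wpmul2l ?lee_fin ?invr_ge0// leeD.
  move: Mfin M0; case: M {GM} => // r _ _.
  by rewrite -EFinD -EFinM lee_fin; lra.
have : (0 <= energy b p phi)%E.
  by rewrite mule_ge0 ?lee_fin ?invr_ge0// esum_ge0// => z _; rewrite lee_fin; exact: E0.
move: key; case: (energy b p phi) => [Q||]//; last first.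
  by move=> _ _; rewrite gt0_muley ?leey// lte_fin mulr_gt0// powR_gt0.
move: Mfin M0; case: M {GM} => // r _ _; rewrite -!EFinM -EFinD !lee_fin => key _.
(* Absorption: [h - (1 - 1/p) h = h / p]. *)
have {}key : h * r <= p * (k `^ (p - 1) * Q).
  rewrite -ler_pdivrMl//; move: key; rewrite cE => key.
  have -> : p^-1 * (h * r) = h * r - (1 - p^-1) * h * r by ring.
  lra.
have h1 : 0 < h `^ (p - 1) by exact: powR_gt0.
rewrite -(mulr_powRB1 (ltW h0) p0) -(mulr_powRB1 (ltW p0) p0).
(* Multiplying by [h^(p-1)] removes [h] from [k^(p-1) = p^(p-1) 2^(1-p) h^(1-p)] and produces the
   stated constant. *)
have -> : 2 `^ (1 - p) * (p * p `^ (p - 1)) * Q =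
  h `^ (p - 1) * (p * (k `^ (p - 1) * Q)).
  rewrite /k powRM ?invr_ge0 ?mulr_ge0 ?(ltW h0) ?(ltW p0)//.
  rewrite -powR_inv1 ?mulr_ge0 ?(ltW h0)// -powRrM mulN1r powRM ?(ltW h0)//.
  rewrite opprB -(opprB p 1) [h `^ (- _)]powRN.
  by field; rewrite gt_eqF.
by rewrite [leLHS]mulrAC [leLHS]mulrC ler_pM2l.
Qed.

End Intrinsic.

Theorem theorem6p1 (R : realType) (X : choiceType)
    (X_countable : countable [set: X]) (X_infinite : infinite_set [set: X])
    (m : X -> R) (m_gt0 : forall x, 0 < m x)
    (b : X -> X -> R) (b_graph : connected_graph b)
    (p : R) (p_gt1 : 1 < p)
    (g : X -> R) (g_gt0 : forall x, 0 < g x)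
    (rho : X -> X -> R)
    (rho_intrinsic : intrinsic p b (density m g) rho) :
  (1 / cheeger b (density m g) <= hardy_norm b m p g)%E /\
  (hardy_norm b m p g <=
    (2 `^ (1 - p) * p `^ p)%:E /
      cheeger (fun x y => (b x y * rho x y)%R) (density m g) `^ p)%E.
Proof.
have p0 : 0 < p by lra.
have mu0 := density_gt0 _ _ _ _ m_gt0 g_gt0.
split; first by rewrite div1e; exact: hardy_norm_ge_inv_cheeger.
have C0 : 0 < 2 `^ (1 - p) * p `^ p by rewrite mulr_gt0// powR_gt0.
have h0 := cheeger_ge0 _ _ _ _ (brho_ge0 _ _ _ _ _ _ b_graph rho_intrinsic) mu0.
have hy := intrinsic_cheeger_lty _ _ _ _ _ _ b_graph p_gt1 mu0 rho_intrinsic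
  (infinite_setN0 X_infinite).
case hE : (cheeger _ _) h0 hy => [h||]// + _.
(* If the Cheeger constant is [0], its power is [0], whose inverse is [+oo], so the bound is
   trivial. *)
rewrite lee_fin le_eqVlt => /predU1P[<-|h0].
  by rewrite poweR0r ?gt_eqF// inve0 gt0_muley ?leey// lte_fin.
rewrite poweR_EFin inver gt_eqF ?powR_gt0//.
apply: ge_ereal_sup => _ [phi [phic /eqP Qn0] <-].
have := hardy_cheeger_bound _ _ _ _ _ _ b_graph p_gt1 mu0 rho_intrinsic _ _ hE h0 phic.
have : (0 <= energy b p phi)%E.
  rewrite mule_ge0 ?lee_fin ?invr_ge0// esum_ge0// => z _.
  by rewrite lee_fin mulr_ge0 ?powR_ge0//; exact: graph_ge0.
have hp0 : 0 < h `^ p by exact: powR_gt0.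
(* A test function of infinite energy has quotient [0], because the inverse of [+oo] is [0]. *)
case: (energy b p phi) Qn0 => [Q||]// Qn0; last first.
  by move=> _ _; rewrite invey mule0 -EFinM lee_fin divr_ge0 ?(ltW C0) ?(ltW hp0).
rewrite eqe in Qn0; rewrite lee_fin => Qge0; have Q0 : 0 < Q by rewrite lt_def Qn0.
rewrite inver (negbTE Qn0) lee_pdivlMr// muleC => H.
by rewrite muleAC lee_pdivrMr.
Qed.
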